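(* Let $(b_i)_{i\in I}$ be a basis of $U$, and for $k\in K$ let $\lambda_k\in\mathrm{End}(U)$ be the $K$-linear map with $b_i\mapsto kb_i$ ($i\in I$). Then the set $\mathcal S$ of complements of $W$ in $V$ is a left vector space over $K$ with addition $$U^{(\gamma,1)}+U^{(\eta,1)}=U^{(\gamma+\eta,1)}$$ and scalar multiplication $$k\cdot U^{(\gamma,1)}=U^{(\lambda_k\gamma,1)}$$ (where $\gamma,\eta\in\mathrm{Hom}(U,W)$, $k\in K$).
   Context: $K$ is a not necessarily commutative field (division ring), $V$ is a left vector space over $K$ of arbitrary (possibly infinite) dimension, and $W\le V$ is a subspace with $W\ne\{0\}$, $W\neq V$. $\mathcal S:=\{S\le V\mid V=W\oplus S\}$ is the set of complements of $W$, and $U\in\mathcal S$ is fixed. Linear maps are written as exponents on the right and composed from left to right: $v^{\phi\psi}=(v^\phi)^\psi$. $\mathrm{Hom}(U,W)$ is the set of $K$-linear maps $U\to W$. For $\gamma\in\mathrm{Hom}(U,W)$ put $U^{(\gamma,1)}:=\{u^\gamma+u\mid u\in U\}$; the map $\gamma\mapsto U^{(\gamma,1)}$ is a bijection $\mathrm{Hom}(U,W)\to\mathcal S$. *)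

(* Defs.v *)
From HB Require Import structures.
From mathcomp Require Import all_boot all_order all_algebra.
From mathcomp Require Import mathcomp_extra boolp classical_sets.

Set Implicit Arguments.
Unset Strict Implicit.
Unset Printing Implicit Defensive.

Import GRing.Theory.
Local Open Scope ring_scope.
Local Open Scope classical_set_scope.

(* The dimension is arbitrary, so subspaces are closed subsets rather than
   elements of {vspace V}. *)
Record subspace (K : nzRingType) (V : lmodType K) := Subspace {
  subspace_set :> set V;
  subspaceP : GRing.submod_closed (mem subspace_set) }.

Definition subspace_pred (K : nzRingType) (V : lmodType K) (W : subspace V) :
  {pred V} := mem (subspace_set W).
HB.instance Definition _ (K : nzRingType) (V : lmodType K) (W : subspace V) :=
  GRing.isSubmodClosed.Build K V (subspace_pred W) (subspaceP W).

Record vect (K : nzRingType) (V : lmodType K) (W : subspace V) := Vect {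
  vect_val :> V;
  vect_valP : vect_val \in subspace_pred W }.
HB.instance Definition _ (K : nzRingType) (V : lmodType K) (W : subspace V) :=
  [isSub for @vect_val K V W].
HB.instance Definition _ (K : nzRingType) (V : lmodType K) (W : subspace V) :=
  [Choice of vect W by <:].
HB.instance Definition _ (K : nzRingType) (V : lmodType K) (W : subspace V) :=
  [SubChoice_isSubLmodule of vect W by <:].

Definition is_complement (K : nzRingType) (V : lmodType K) (W S : subspace V) :=
  W `&` S = [set 0] /\ [set w + s | w in W & s in S] = setT.

Record complement (K : nzRingType) (V : lmodType K) (W : subspace V) :=
  Complement {
    complement_sub :> subspace V;
    complementP : is_complement W complement_sub }.

Section Graph.
Variables (K : nzRingType) (V : lmodType K) (W : subspace V).
Variables (U : complement W) (gamma : {linear vect U -> vect W}).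

Let graph_set : set V := [set vect_val (gamma u) + vect_val u | u in setT].

Let graph_submod : GRing.submod_closed (mem graph_set).
Proof.
split; first by rewrite inE; exists 0 => //; rewrite !raddf0 addr0.
move=> k x y; rewrite !inE => -[u _ <-] [v _ <-]; exists (k *: u + v) => //.
by rewrite linearP /= scalerDr addrACA.
Qed.

Definition graph_subspace : subspace V := Subspace graph_submod.

Lemma graph_is_complement : is_complement W graph_subspace.
Proof.
have [UW0 UWT] := complementP U; split; apply/seteqP; split => x //=.
- move=> [Wx [u _ ux]].
  have uU : subspace_set U (vect_val u) by have := vect_valP u; rewrite inE.
  have uW : subspace_set W (vect_val u).
    rewrite -in_setE (_ : vect_val u = x - vect_val (gamma u)); last first.
      by rewrite -ux addrAC subrr add0r.
    apply: (@rpredB V (subspace_pred W)); last exact: vect_valP.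
    by rewrite inE.
  have u0 : u = 0.
    by apply: val_inj => /=; have : (W `&` U) (vect_val u) by []; rewrite UW0.
  by rewrite -ux u0 !raddf0 addr0.
- move=> ->; split; rewrite -in_setE.
    exact: (@rpred0 V (subspace_pred W)).
  exact: (@rpred0 V (subspace_pred graph_subspace)).
- move=> _; have : [set: V] x by [].
  rewrite -UWT => -[w Ww [s Us <-]].
  have sU : s \in subspace_pred U by rewrite inE.
  pose u : vect U := Vect sU.
  exists (w - vect_val (gamma u)); last first.
    exists (vect_val (gamma u) + s); first by exists u.
    by rewrite addrA subrK.
  rewrite -in_setE; apply: (@rpredB V (subspace_pred W)); last exact: vect_valP.
  by rewrite inE.
Qed.

(* U^(gamma,1), with gamma acting on the right: the set of all u^gamma + u. *)
Definition graph : complement W := Complement graph_is_complement.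

End Graph.

Section Basis.
Variables (K : nzRingType) (L : lmodType K) (I : eqType).

Definition is_basis (b : I -> L) :=
  (forall (s : seq I) (c : I -> K), uniq s ->
     \sum_(i <- s) c i *: b i = 0 -> {in s, forall i, c i = 0}) /\
  (forall u : L, exists (s : seq I) (c : I -> K), u = \sum_(i <- s) c i *: b i).

Let comb (M : lmodType K) (g : I -> M) (t : seq (K * I)) : M :=
  \sum_(p <- t) p.1 *: g p.2.

Let combE (M : lmodType K) (g : I -> M) t :
  comb g t = \sum_(i <- undup (map snd t)) (\sum_(p <- t | p.2 == i) p.1) *: g i.
Proof.
under eq_bigr => i _ do rewrite scaler_suml big_mkcond /=.
rewrite exchange_big /=; apply: eq_big_seq => p pt.
have pm : p.2 \in undup (map snd t) by rewrite mem_undup map_f.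
rewrite (bigD1_seq p.2) ?undup_uniq //= eqxx big1 ?addr0 // => i /negPf.
by rewrite eq_sym => ->.
Qed.

Let comb_lin (M : lmodType K) (g : I -> M) k t t' :
  comb g ([seq (k * p.1, p.2) | p <- t] ++ t') = k *: comb g t + comb g t'.
Proof.
rewrite /comb big_cat big_map scaler_sumr; congr (_ + _).
by apply: eq_bigr => p _; rewrite scalerA.
Qed.

Lemma linear_extension (b : I -> L) (M : lmodType K) (g : I -> M) :
  is_basis b -> exists f : {linear L -> M}, forall i, f (b i) = g i.
Proof.
move=> [free span].
have comb0 t : comb b t = 0 -> comb g t = 0.
  rewrite !combE => /free c0; rewrite big_seq big1 // => i it.
  by rewrite c0 ?scale0r ?undup_uniq.
have combI t t' : comb b t = comb b t' -> comb g t = comb g t'.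
  move=> e; apply/eqP; rewrite -subr_eq0 addrC -scaleN1r -comb_lin.
  by apply/eqP/comb0; rewrite comb_lin e scaleN1r addNr.
have spant u : exists t, comb b t = u.
  have [s [c ->]] := span u.
  by exists [seq (c i, i) | i <- s]; rewrite /comb big_map.
pose T u := projT1 (cid (spant u)).
have TE u : comb b (T u) = u := projT2 (cid (spant u)).
pose f u := comb g (T u).
have f_lin : linear f.
  by move=> k u v; rewrite /f -comb_lin; apply: combI; rewrite comb_lin !TE.
exists (HB.pack_for {linear L -> M} f (GRing.isLinear.Build K L M _ f f_lin)).
move=> i /=; rewrite (_ : g i = comb g [:: (1, i)]).
  by apply: combI; rewrite TE /comb big_seq1 scale1r.
by rewrite /comb big_seq1 scale1r.
Qed.

Lemma linear_ext_unique (b : I -> L) (M : lmodType K) (f f' : {linear L -> M}) :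
  is_basis b -> (forall i, f (b i) = f' (b i)) -> f =1 f'.
Proof.
move=> [_ span] ff' u; have [s [c ->]] := span u.
by rewrite !linear_sum; apply: eq_bigr => i _; rewrite !linearZ /= ff'.
Qed.

(* lambda_k: the endomorphism with b i |-> k *: b i.  Over a noncommutative K
   it is in general different from u |-> k *: u, which need not be linear. *)
Definition basis_scale (b : I -> L) (hb : is_basis b) (k : K) : {linear L -> L} :=
  projT1 (cid (linear_extension (fun i => k *: b i) hb)).

Lemma basis_scaleE (b : I -> L) (hb : is_basis b) (k : K) (i : I) :
  basis_scale hb k (b i) = k *: b i.
Proof. exact: (projT2 (cid (linear_extension (fun i => k *: b i) hb))). Qed.

End Basis.

(* Main.v *)
Require Import Defs.
From HB Require Import structures.
From mathcomp Require Import all_boot all_order all_algebra.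
From mathcomp Require Import mathcomp_extra boolp classical_sets.
From mathcomp Require Import functions.

Set Implicit Arguments.
Unset Strict Implicit.
Unset Printing Implicit Defensive.

Import GRing.Theory.
Local Open Scope ring_scope.
Local Open Scope classical_set_scope.

(** Every complement of [W] is the graph of exactly one linear map from [U] to
    [W] ([graph_surj], [graph_inj]), and a linear map is determined by its values
    on the basis [b], which are arbitrary.  Hence [graph gamma |-> gamma \o b]
    is a bijection from the complements of [W] onto the families [I -> vect W].
    These families form a left vector space under pointwise operations, whose
    structure is transported along the bijection ([transport_lmodule]).
    Addition of families is addition of linear maps, and since
    [gamma (k *: b i) = k *: gamma (b i)], scaling the family by [k] amounts to
    precomposing [gamma] with [basis_scale hb k].

    Passing to families is what makes noncommutativity of [K] harmless: scaling
    a linear map pointwise need not give a linear map, whereas scaling its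
    values on the basis is always possible. *)

(** Decidable equality and choice on [T] are taken from classical logic, so that
    [T] may be a bare type. *)
Lemma transport_lmodule (K : nzRingType) (L : lmodType K) (T : Type)
    (f : T -> L) : bijective f ->
  exists vs : GRing.Lmodule K T, let S : lmodType K := GRing.Lmodule.Pack vs in
    (forall x y : S, f (x + y) = f x + f y) /\
    (forall (k : K) (x : S), f (k *: x) = k *: f x).
Proof.
move=> [g fK gK].
pose add x y := g (f x + f y).
have addA : associative add by move=> x y z; rewrite /add !gK addrA.
have addC : commutative add by move=> x y; rewrite /add addrC.
have add0 : left_id (g 0) add by move=> x; rewrite /add gK add0r fK.
have addN : left_inverse (g 0) (fun x => g (- f x)) add.
  by move=> x; rewrite /add gK addNr.
pose scale k x := g (k *: f x).
have scaleA a b x : scale a (scale b x) = scale (a * b) x.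
  by rewrite /scale gK scalerA.
have scale1 : left_id 1 scale by move=> x; rewrite /scale scale1r fK.
have scaleDr : right_distributive scale add.
  by move=> k x y; rewrite /scale /add !gK scalerDr.
have scaleDl x : {morph scale^~ x : a b / a + b >-> add a b}.
  by move=> a b; rewrite /scale /add !gK scalerDl.
pose C := HB.pack_for choiceType T (gen_eqMixin T) (gen_choiceMixin T).
pose Z := HB.pack_for zmodType T C
  (@GRing.isZmodule.Build C _ _ _ addA addC add0 addN).
pose S := HB.pack_for (lmodType K) T Z
  (@GRing.Zmodule_isLmodule.Build K Z scale scaleA scale1 scaleDr scaleDl).
by exists (GRing.Lmodule.class S); split=> *; apply: gK.
Qed.

Lemma complement_eq (K : nzRingType) (V : lmodType K) (W : subspace V)
    (S T : complement W) :
  subspace_set S = subspace_set T -> S = T.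
Proof.
case: S T => [[S hS] cS] [[T hT] cT] /= eST; case: _ / eST in hT cT *.
rewrite (Prop_irrelevance hT hS) in cT *.
by rewrite (Prop_irrelevance cT cS).
Qed.

(** A vector lying in both [W] and [S] vanishes, so the [W]- and [S]-components
    of a vector are unique. *)
Lemma complement_cancel (K : nzRingType) (V : lmodType K) (W : subspace V)
    (S : complement W) (w w' s s' : V) :
    w \in subspace_pred W -> w' \in subspace_pred W ->
    s \in subspace_pred S -> s' \in subspace_pred S ->
  w + s = w' + s' -> w = w' /\ s = s'.
Proof.
move=> Ww Ww' Ss Ss' e.
have [WS0 _] := complementP S.
have d : w - w' = s' - s.
  by apply/eqP; rewrite subr_eq addrAC eq_sym subr_eq addrC -e addrC.
have Wd : w - w' \in subspace_pred W by apply: rpredB.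
have Sd : w - w' \in subspace_pred S by rewrite d; apply: rpredB.
have d0 : w - w' = 0.
  have : (W `&` S) (w - w') by split; rewrite -in_setE.
  by rewrite WS0.
split; first by apply/eqP; rewrite -subr_eq0 d0.
by apply/esym/eqP; rewrite -subr_eq0 -d d0.
Qed.

Section GraphBijection.
Variables (K : nzRingType) (V : lmodType K) (W : subspace V).
Variable U : complement W.

Lemma graph_inj (gamma eta : {linear vect U -> vect W}) :
  graph gamma = graph eta -> gamma =1 eta.
Proof.
move=> e u.
have : subspace_set (graph gamma) (vect_val (gamma u) + vect_val u).
  by exists u.
rewrite e => -[v _] evu.
have [eg uv] := complement_cancel (vect_valP _) (vect_valP _) (vect_valP _)
  (vect_valP _) evu.
by apply: val_inj; rewrite /= -eg (val_inj uv).
Qed.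

(** The map with graph [S] sends [u] to the unique [w] in [W] such that
    [w + u] lies in [S]: it is minus the [W]-component of [u] with respect to
    [S].  Uniqueness makes it linear. *)
Lemma graph_surj (S : complement W) :
  exists gamma : {linear vect U -> vect W}, graph gamma = S.
Proof.
have [_ WS] := complementP S; have [_ WU] := complementP U.
have ex (u : vect U) :
    exists w : vect W, vect_val w + vect_val u \in subspace_pred S.
  have : [set: V] (vect_val u) by [].
  rewrite -WS => -[w Ww [s Ss eu]].
  have NWw : - w \in subspace_pred W by rewrite rpredN inE.
  by exists (Vect NWw); rewrite /= -eu addKr inE.
pose g u := projT1 (cid (ex u)).
have gS u : vect_val (g u) + vect_val u \in subspace_pred S.
  exact: projT2 (cid (ex u)).
have g_unique (u : vect U) (w : V) : w \in subspace_pred W ->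
    w + vect_val u \in subspace_pred S -> w = vect_val (g u).
  move=> Ww Sw.
  have e : w + (vect_val (g u) + vect_val u) =
           vect_val (g u) + (w + vect_val u) by rewrite addrCA.
  exact: (complement_cancel Ww (vect_valP _) (gS u) Sw e).1.
have g_lin : linear g.
  move=> k u v; apply: val_inj; rewrite /=; apply/esym/g_unique.
    by rewrite rpredD ?rpredZ ?vect_valP.
  by rewrite addrACA -scalerDr rpredD ?rpredZ.
exists (HB.pack_for {linear vect U -> vect W} g
  (GRing.isLinear.Build K _ _ _ g g_lin)).
apply/complement_eq/seteqP; split=> x /=.
  by move=> [u _ <-]; rewrite -in_setE; apply: gS.
move=> Sx; have : [set: V] x by [].
rewrite -WU => -[w Ww [u Uu wu]].
have Uu' : u \in subspace_pred U by rewrite inE.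
exists (Vect Uu') => //=.
by rewrite -(@g_unique (Vect Uu') w) //= ?inE // wu.
Qed.

Variables (I : eqType) (b : I -> vect U) (hb : is_basis b).

Definition complement_coord (S : complement W) : I -> vect W :=
  fun i => projT1 (cid (graph_surj S)) (b i).

Lemma complement_coord_graph (gamma : {linear vect U -> vect W}) :
  complement_coord (graph gamma) = gamma \o b.
Proof.
apply/funext => i; rewrite /complement_coord.
by case: cid => eta /= /graph_inj ->.
Qed.

Lemma complement_coord_bij : bijective complement_coord.
Proof.
pose ext (h : I -> vect W) := projT1 (cid (linear_extension h hb)).
have extE h i : ext h (b i) = h i := projT2 (cid (linear_extension h hb)) i.
exists (fun h => graph (ext h)) => [S|h]; last first.
  by rewrite complement_coord_graph; apply/funext => i /=; rewrite extE.
have [gamma <-] := graph_surj S; rewrite complement_coord_graph.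
have eg : ext (gamma \o b) =1 gamma.
  by apply: (linear_ext_unique hb) => i; rewrite extE.
apply/complement_eq/seteqP.
by split=> _ [u _ <-]; exists u; rewrite // eg.
Qed.

End GraphBijection.

Theorem proposition2p2
  (K : unitRingType) (hK : forall x : K, x != 0 -> x \is a GRing.unit)
  (V : lmodType K)
  (W : subspace V) (W_neq0 : subspace_set W <> [set 0])
  (W_neqT : subspace_set W <> setT)
  (U : complement W) (I : eqType) (b : I -> vect U) (hb : is_basis b) :
  exists vs : GRing.Lmodule K (complement W),
    let S : lmodType K := GRing.Lmodule.Pack vs in
    (forall gamma eta : {linear vect U -> vect W},
       (graph gamma : S) + (graph eta : S) = graph (gamma \+ eta)) /\
    (forall (k : K) (gamma : {linear vect U -> vect W}),
       k *: (graph gamma : S) = graph (gamma \o basis_scale hb k)).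
Proof.
have bij := @complement_coord_bij K V W U I b hb.
have [vs [coordD coordZ]] := transport_lmodule bij.
exists vs; split=> [gamma eta|k gamma]; apply: (bij_inj bij).
  by rewrite coordD !complement_coord_graph.
rewrite coordZ !complement_coord_graph; apply/funext => i /=.
by rewrite basis_scaleE linearZ.
Qed.
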